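(* Let $n\geq 4$ be even. Among all $n$-vertex conjugated trees, the tree $S_{*}$ of order $n$ has the minimal total-eccentricity index; that is, $\tau(S_* )\leq \tau(T)$ for every $n$-vertex conjugated tree $T$.
   Context: All graphs are finite and simple. For a connected graph $G$, the eccentricity $e_G(v)$ of a vertex $v$ is the largest distance from $v$ to any other vertex of $G$. The total-eccentricity index of $G$ is $\tau(G)=\sum_{u\in V(G)} e_G(u)$. A conjugated graph is a graph containing a perfect matching (so its order is even). For $m\ge 2$, the subdivided star $S_{m,2}$, of order $2m-1$, is obtained from the star $S_m$ on $m$ vertices by subdividing every edge exactly once. The tree $S_*$ of order $n$ is obtained from $S_{n/2+1,2}$ by deleting one pendant vertex; equivalently, $S_*$ consists of a vertex $c$, one pendant vertex adjacent to $c$, and $n/2-1$ paths $c\,v_i\,w_i$ of length $2$ which pairwise share only the vertex $c$. *)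

(* Defs.v *)
From mathcomp Require Import all_boot.

Set Implicit Arguments.
Unset Strict Implicit.
Unset Printing Implicit Defensive.

Record sgraph := SGraph {
  vertex :> finType;
  adj : rel vertex;
  adj_sym : symmetric adj;
  adj_irrefl : irreflexive adj }.

Section Notions.
Variable G : sgraph.

Definition connected : Prop := forall x y : G, connect (@adj G) x y.

Definition acyclic : Prop :=
  forall c : seq G, 2 < size c -> ~~ ucycleb (@adj G) c.

Definition is_tree : Prop := connected /\ acyclic.

Definition edges : {set {set G}} :=
  [set [set p.1; p.2] | p in [pred p : G * G | adj p.1 p.2]].

Definition perfect_matching (M : {set {set G}}) : bool :=
  (M \subset edges) && partition M [set: G].

Definition conjugated : Prop := exists M, perfect_matching M.

Definition walk (k : nat) (x y : G) : bool :=
  [exists p : k.-tuple G, path (@adj G) x p && (last x p == y)].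

(* The search stops below #|G| because a shortest path has no repeated vertex;
   vertices in different components get the junk value #|G| (see distP). *)
Definition dist (x y : G) : nat :=
  find (fun k => walk k x y) (iota 0 #|G|).

Definition ecc (v : G) : nat := \max_(u : G | u != v) dist v u.

Definition tau : nat := \sum_(u : G) ecc u.

Lemma walkP k x y :
  reflect (exists p : seq G,
             [/\ size p = k, path (@adj G) x p & last x p = y])
          (walk k x y).
Proof.
apply: (iffP existsP) => [[p /andP[pp /eqP lp]]|[p [sp pp lp]]].
  by exists p; rewrite size_tuple.
have sp' : size p == k by apply/eqP.
by exists (Tuple sp'); rewrite /= pp lp eqxx.
Qed.

Lemma distP (x y : G) :
  connect (@adj G) x y ->
  walk (dist x y) x y /\ (forall k, walk k x y -> dist x y <= k).
Proof.
move=> /connectP[p pp ->].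
case: (shortenP pp) => q pq uq _.
set y' := last x q.
have ltq : size (x :: q) <= #|G| by rewrite -(card_uniqP uq) max_card.
have wq : walk (size q) x y' by apply/walkP; exists q.
have hs : has (fun k => walk k x y') (iota 0 #|G|).
  by apply/hasP; exists (size q); rewrite ?mem_iota.
have ltd : dist x y' < #|G| by move: hs; rewrite has_find size_iota.
split; first by move: (nth_find 0 hs); rewrite -/(dist x y') nth_iota.
move=> k wk; rewrite leqNgt; apply/negP => ltk.
by move: (before_find 0 ltk); rewrite nth_iota ?wk // (ltn_trans ltk ltd).
Qed.

End Notions.

Section Sstar.
Variable n : nat.

(* Encoding: inl false is the centre c, inl true is its pendant neighbour,
   inr (i, false) is v_i and inr (i, true) is w_i, for n/2 - 1 indices i. *)
Definition Sstar_vertex : finType := (bool + 'I_(n./2).-1 * bool)%type.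

Definition Sstar_arc (x y : Sstar_vertex) : bool :=
  match x, y with
  | inl false, inl true => true
  | inl false, inr (_, false) => true
  | inr (i, false), inr (j, true) => i == j
  | _, _ => false
  end.

Definition Sstar_adj : rel Sstar_vertex :=
  [rel x y | Sstar_arc x y || Sstar_arc y x].

Fact Sstar_adj_sym : symmetric Sstar_adj.
Proof. by move=> x y; rewrite /Sstar_adj /= orbC. Qed.

Fact Sstar_adj_irrefl : irreflexive Sstar_adj.
Proof. by move=> [[]|[i []]]. Qed.

Definition Sstar : sgraph := SGraph Sstar_adj_sym Sstar_adj_irrefl.

End Sstar.

(* Main.v *)
Require Import Defs.
From mathcomp Require Import all_boot.
From mathcomp Require Import zify.

Set Implicit Arguments.
Unset Strict Implicit.
Unset Printing Implicit Defensive.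

(** Write n = 2m + 2. In a tree with a perfect matching, sum the eccentricities
    along the matching edges: if p sends a vertex to its partner, then
    2 tau(T) is the sum over all x of f(x) = ecc x + ecc (p x). Let c be a
    vertex of minimal eccentricity. It suffices that f is at least 5 on the
    pair {c, p c} and at least 7 on every other vertex, or at least 5 there
    when n = 4: then 2 tau(T) >= 10 + 2m (5 + 2 [m > 1]), and explicit walks
    show that the spider attains this bound.

    Two properties of a tree carry the estimates of f, and both come from the
    fact that each edge uv is a bridge ([edge_bridge]): distances from a fixed
    vertex to u and to v differ by exactly one ([dist_edge_parity]), and
    distances between vertices on opposite sides of uv add up through the edge
    ([dist_across_edge]). Consequently two adjacent vertices of equal
    eccentricity k force all other eccentricities above k ([ecc_edge_min]),
    since the vertices farthest from u lie across the edge, and the other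
    vertices on the side of u can reach them only through u.

    If ecc c >= 3, a pair avoiding c cannot have equal eccentricities, as that
    of c would then not be minimal; so it contributes at least 3 + 4 = 7. If
    ecc c <= 2, each pair avoiding c is a leg c - v - w. The vertex p c is at
    distance 3 from w and 2 from v, and w is at distance 2 from c, so both
    pairs contribute at least 2 + 3 = 5; with a second leg c - v' - w', the ends w and w'
    are at distance 4 and w' is at distance 3 from v, which gives
    3 + 4 = 7. *)

(** * Distances in a connected graph *)

Section ConnectedDistance.
Variable G : sgraph.
Hypothesis connG : connected G.

Lemma dist_path (x y : G) :
  exists p, [/\ path (@adj G) x p, last x p = y & size p = dist x y].
Proof.
have [/walkP[p [sp pp lp]] _] := distP (connG x y).
by exists p.
Qed.

Lemma dist_le_size (x : G) p : path (@adj G) x p -> dist x (last x p) <= size p.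
Proof.
move=> pp; have [_] := distP (connG x (last x p)); apply.
by apply/walkP; exists p.
Qed.

Lemma distxx (x : G) : dist x x = 0.
Proof. by have := @dist_le_size x [::] isT; rewrite leqn0 => /eqP. Qed.

Lemma dist_eq0 (x y : G) : (dist x y == 0) = (x == y).
Proof.
apply/eqP/eqP => [d0|->]; last exact: distxx.
by have [[|z p] [_ //=]] := dist_path x y; rewrite d0.
Qed.

Lemma dist_triangle (y x z : G) : dist x z <= dist x y + dist y z.
Proof.
have [p [pp lp <-]] := dist_path x y; have [q [pq lq <-]] := dist_path y z.
have := @dist_le_size x (p ++ q).
by rewrite cat_path last_cat size_cat pp lp pq lq; apply.
Qed.

Lemma dist_sym (x y : G) : dist x y = dist y x.
Proof.
suff le (a b : G) : dist b a <= dist a b by apply/eqP; rewrite eqn_leq !le.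
have [p [pp <- <-]] := dist_path a b.
have := @dist_le_size (last a p) (rev (belast a p)).
rewrite rev_path size_rev size_belast.
have -> : last (last a p) (rev (belast a p)) = a.
  by case: p {pp} => //= z p; rewrite rev_cons last_rcons.
by apply; rewrite (eq_path (e' := @adj G)) // => u v; rewrite /= adj_sym.
Qed.

Lemma dist_adj (x y : G) : adj x y -> dist x y = 1.
Proof.
move=> axy; have := @dist_le_size x [:: y]; rewrite /= axy => /(_ isT).
have : dist x y != 0.
  by rewrite dist_eq0; apply: contraTneq axy => ->; rewrite adj_irrefl.
lia.
Qed.

Lemma adj_dist1 (x y : G) : dist x y = 1 -> adj x y.
Proof.
move=> d1; have [[|z [|? ?]]] := dist_path x y; rewrite d1; case=> //=.
by rewrite andbT => ? <-.
Qed.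

Lemma dist_le_ecc (x y : G) : dist x y <= ecc x.
Proof.
have [->|yx] := eqVneq y x; first by rewrite distxx.
exact: (leq_bigmax_cond (F := fun u => dist x u)).
Qed.

Lemma ecc_attained (x : G) : exists y, dist x y = ecc x.
Proof.
case: (arg_maxnP (dist x) (isT : xpredT x)) => y _ ymax; exists y.
apply/eqP; rewrite eqn_leq dist_le_ecc; apply/bigmax_leqP => z _.
exact: ymax.
Qed.

(** A shortest walk from [x] to [y] has to leave [A], and its first exit can
    only be the step from [u] to [v]; cut the walk there. *)
Lemma dist_across_bridge (A : {set G}) (u v x y : G) :
  (forall a b, a \in A -> b \notin A -> adj a b -> a = u /\ b = v) ->
  x \in A -> y \notin A -> dist x u + 1 + dist v y <= dist x y.
Proof.
move=> only_uv xA yA; have [p [pp lp <-]] := dist_path x y.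
elim: p x xA pp lp => [|z p IHp] x xA /=.
  by move=> _ xy; rewrite -xy xA in yA.
move=> /andP[axz pp] lp; have [zA|zA] := boolP (z \in A).
  have := IHp z zA pp lp; have := dist_triangle z x u.
  rewrite (dist_adj axz); lia.
have [-> zv] := only_uv x z xA zA axz; subst z.
have := dist_le_size pp; rewrite lp distxx; lia.
Qed.

End ConnectedDistance.

(** * Distances in a tree *)

Section TreeDistance.
Variable T : sgraph.
Hypothesis treeT : is_tree T.
Let connT : connected T := treeT.1.

(** [A] is the component of [u] once the edge is deleted. It cannot contain
    [v]: a simple path from [u] to [v] in the rest of the graph would close up
    into a cycle with the deleted edge. *)
Lemma edge_bridge (u v : T) : adj u v ->
  exists A : {set T}, [/\ u \in A, v \notin A &
    forall a b, a \in A -> b \notin A -> adj a b -> a = u /\ b = v].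
Proof.
move=> auv.
pose e' := [rel a b : T | [&& adj a b, (a, b) != (u, v) & (a, b) != (v, u)]].
exists [set x | connect e' u x].
have nuv : v \notin [set x | connect e' u x].
  rewrite inE; apply/negP => /connectP[p pp lp].
  case: (shortenP pp) lp => q pq uq _ vq.
  have pq' : path (@adj T) u q by apply: sub_path pq => a b /and3P[].
  have sq : 2 < size (u :: q).
    case: q pq vq {uq pq'} => [|a [|b q]] //=.
      by move=> _ vu; rewrite vu adj_irrefl in auv.
    by move=> /andP[/and3P[_ + _] _] va; rewrite va eqxx.
  have /negP[] := treeT.2 _ sq.
  by rewrite /ucycleb /= rcons_path pq' -vq adj_sym auv.
split=> // [|a b aA bA aab]; first by rewrite inE connect0.
have /nandP[/negPn/eqP[]|/negPn/eqP[av _]] //: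
    ~~ (((a, b) != (u, v)) && ((a, b) != (v, u))).
  apply: contra bA => nab; move: aA; rewrite !inE => /connect_trans; apply.
  by apply: connect1; rewrite /= aab.
by rewrite -av aA in nuv.
Qed.

(** Trees are bipartite, so the two distances cannot be equal. *)
Lemma dist_edge_parity (x u v : T) : adj u v ->
  dist x u = (dist x v).+1 \/ dist x v = (dist x u).+1.
Proof.
move=> auv; have [A [uA vA only_uv]] := edge_bridge auv.
have tuv := dist_triangle connT v x u; have tvu := dist_triangle connT u x v.
rewrite (dist_sym connT v u) (dist_adj connT auv) in tuv tvu.
have [xA|xA] := boolP (x \in A).
  have := dist_across_bridge connT only_uv xA vA; lia.
have := dist_across_bridge connT only_uv uA xA.
rewrite !(dist_sym connT _ x); lia.
Qed.

(** The inequality [dist x u < dist x v] expresses that [x] lies on the side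
    of [u] without naming the component. *)
Lemma dist_across_edge (x y u v : T) : adj u v ->
  dist x u < dist x v -> dist y v < dist y u ->
  dist x u + 1 + dist v y <= dist x y.
Proof.
move=> auv xu yv; have [A [uA vA only_uv]] := edge_bridge auv.
apply: (dist_across_bridge connT only_uv).
  apply/negPn/negP => xA; have := dist_across_bridge connT only_uv uA xA.
  rewrite !(dist_sym connT _ x); lia.
apply/negP => yA; have := dist_across_bridge connT only_uv yA vA; lia.
Qed.

(** A vertex [x] farthest from [u] lies on the side of [v], for otherwise it
    would be still farther from [v]. Any other [w] on the side of [u] reaches
    [x] only through [u], hence is farther from [x] than [u] is. *)
Lemma ecc_edge_min (u v w : T) : adj u v -> ecc u = ecc v ->
  w != u -> w != v -> ecc u < ecc w.
Proof.
wlog wu : u v / dist w u < dist w v => [hw|].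
  move=> auv euv wu wv; have [d|d] := dist_edge_parity w auv.
    by rewrite euv; apply: (hw v u); rewrite ?d // adj_sym.
  by apply: (hw u v); rewrite // d.
move=> auv euv neq_wu _; have [x xu] := ecc_attained connT u.
have lexv := dist_le_ecc connT v x.
rewrite !(dist_sym connT _ x) in xu lexv.
have xuv := dist_edge_parity x auv.
have xv : dist x v < dist x u by lia.
have := dist_across_edge auv wu xv; have := dist_le_ecc connT w x.
move: neq_wu; rewrite -(dist_eq0 connT) (dist_sym connT v x); lia.
Qed.

(** Both distances are positive and at most [ecc c], and their parities
    differ. *)
Lemma radius2_edge (c x y : T) : ecc c <= 2 -> x != c -> y != c -> adj x y ->
  dist c x = 1 /\ dist c y = 2 \/ dist c y = 1 /\ dist c x = 2.
Proof.
move=> ec; rewrite ![_ == c]eq_sym -!(dist_eq0 connT) => cx cy axy.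
have := dist_edge_parity c axy.
have := dist_le_ecc connT c x; have := dist_le_ecc connT c y; lia.
Qed.

(** The vertices [a] and [w] are separated by the edge between [c] and [v]. *)
Lemma dist_other_branch (c v w a : T) :
  dist c v = 1 -> dist c w = 2 -> adj v w -> dist c a = 1 -> a != v ->
  dist a w = 3.
Proof.
move=> cv cw avw ca; rewrite -(dist_eq0 connT) => av.
have acv := adj_dist1 connT cv; have wv := dist_adj connT avw.
have ta := dist_triangle connT c a w.
have := dist_edge_parity a acv; rewrite (dist_sym connT a c) => av2.
have := @dist_across_edge a w c v acv.
rewrite (dist_sym connT a c) !(dist_sym connT w).
rewrite (dist_sym connT a c) in ta; lia.
Qed.

Lemma dist_ends_of_legs (c v w v' w' : T) :
  dist c v = 1 -> dist c w = 2 -> adj v w ->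
  dist c v' = 1 -> dist c w' = 2 -> adj v' w' -> v != v' -> dist w w' >= 4.
Proof.
move=> cv cw avw cv' cw' avw' vv'.
have acv := adj_dist1 connT cv; have wv := dist_adj connT avw.
have vw' := dist_other_branch cv' cw' avw' cv vv'.
have := @dist_across_edge w' w c v acv.
rewrite !(dist_sym connT w') (dist_sym connT w c) (dist_sym connT w v); lia.
Qed.

End TreeDistance.

(** * Perfect matchings as involutions *)

Lemma conjugated_partner (G : sgraph) : conjugated G -> exists p : G -> G,
  involutive p /\ forall x, adj x (p x).
Proof.
move=> [M /andP[/subsetP sM /and3P[/eqP covM tM _]]].
(* the block containing x is an edge, whose other end is the partner *)
have ex x : exists y, ([set x; y] \in M) && adj x y.
  have xM : x \in cover M by rewrite covM inE.
  have BM := pblock_mem xM; have xB : x \in pblock M x by rewrite mem_pblock.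
  have /imsetP[[a b] /= aab EB] := sM _ BM.
  move: BM xB; rewrite EB => BM /set2P[->|->].
    by exists b; rewrite BM.
  by exists a; rewrite setUC BM adj_sym.
pose p x := xchoose (ex x).
have pP x : [set x; p x] \in M /\ adj x (p x) by apply/andP/(xchooseP (ex x)).
exists p; split=> [x|x]; last by case: (pP x).
have [xpM axp] := pP x; have [pxM appx] := pP (p x).
have : [set x; p x] = [set p x; p (p x)].
  rewrite -(def_pblock tM xpM (set22 _ _)).
  by rewrite -(def_pblock tM pxM (set21 _ _)).
move=> E; have : x \in [set p x; p (p x)] by rewrite -E set21.
by case/set2P => // xpx; rewrite -xpx adj_irrefl in axp.
Qed.

(** * Lower bound for conjugated trees *)

Section LowerBound.
Variables (T : sgraph) (p : T -> T).
Hypothesis treeT : is_tree T.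
Let connT : connected T := treeT.1.
Hypotheses (pK : involutive p) (adjp : forall x, adj x (p x)).

Let pair_ecc x := ecc x + ecc (p x).

Lemma pair_eccC x : pair_ecc (p x) = pair_ecc x.
Proof. by rewrite /pair_ecc pK addnC. Qed.

Lemma partner_neq x : p x != x.
Proof. by apply/eqP => E; have := adjp x; rewrite E adj_irrefl. Qed.

Lemma double_tau : (tau T).*2 = \sum_x pair_ecc x.
Proof.
rewrite big_split /= -addnn; congr (_ + _).
by rewrite /tau (reindex_inj (inv_inj pK)).
Qed.

Lemma pair_ecc_radius_ge3 (c x : T) :
  (forall y : T, ecc c <= ecc y) -> 3 <= ecc c -> x != c -> p x != c ->
  7 <= pair_ecc x.
Proof.
move=> cmin ec xc pxc; rewrite /pair_ecc.
have cx := cmin x; have cpx := cmin (p x).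
have [E|] := eqVneq (ecc x) (ecc (p x)); last lia.
rewrite ![_ == c]eq_sym in xc pxc.
have := ecc_edge_min treeT (adjp x) E xc pxc; lia.
Qed.

(** In a leg [c], [x], [p x], the partner of [c] lies in another branch, so
    it is at distance 3 from [p x] and at distance 2 from [x]. *)
Lemma pair_ecc_radius2_centre (c x : T) :
  ecc c <= 2 -> x != c -> p x != c -> 5 <= pair_ecc c /\ 5 <= pair_ecc x.
Proof.
move=> ec; wlog [cx cpx] : x / dist c x = 1 /\ dist c (p x) = 2 => [hw xc pxc|].
  have [|[d1 d2]] := radius2_edge treeT ec xc pxc (adjp x).
    by move=> d; apply: hw.
  by rewrite -(pair_eccC x); apply: hw; rewrite ?pK.
move=> xc pxc; have cpc := dist_adj connT (adjp c).
have pcx : p c != x by apply: contra_neq pxc => <-; rewrite pK.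
have far := dist_other_branch treeT cx cpx (adjp x) cpc pcx.
have := dist_triangle connT x (p c) (p x).
rewrite (dist_adj connT (adjp x)) far (dist_sym connT _ x) => near.
have := dist_le_ecc connT c (p x); have := dist_le_ecc connT (p c) (p x).
have := dist_le_ecc connT x (p c); have := dist_le_ecc connT (p x) (p c).
rewrite (dist_sym connT (p x)) /pair_ecc; lia.
Qed.

(** The pair of [y] is a second leg; its outer end is at distances 3 and 4 from
    the inner and the outer end of the leg of [x]. *)
Lemma pair_ecc_radius2 (c x y : T) : ecc c <= 2 ->
  x != c -> p x != c -> y != c -> p y != c -> y != x -> y != p x ->
  7 <= pair_ecc x.
Proof.
move=> ec.
wlog [cx cpx] : x / dist c x = 1 /\ dist c (p x) = 2
  => [hw xc pxc yc pyc yx ypx|].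
  have [|[d1 d2]] := radius2_edge treeT ec xc pxc (adjp x).
    by move=> d; apply: hw.
  by rewrite -(pair_eccC x); apply: hw; rewrite ?pK.
wlog [cy cpy] : y / dist c y = 1 /\ dist c (p y) = 2
  => [hw xc pxc yc pyc yx ypx|].
  have [|[d1 d2]] := radius2_edge treeT ec yc pyc (adjp y).
    by move=> d; apply: (hw y).
  apply: (hw (p y)); rewrite ?pK //; last by rewrite (inj_eq (inv_inj pK)).
  by apply: contra_neq ypx => <-; rewrite pK.
move=> xc pxc yc pyc yx ypx; rewrite eq_sym in yx.
have := dist_ends_of_legs treeT cx cpx (adjp x) cy cpy (adjp y) yx.
have := dist_other_branch treeT cy cpy (adjp y) cx yx.
have := dist_le_ecc connT x (p y); have := dist_le_ecc connT (p x) (p y).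
rewrite /pair_ecc; lia.
Qed.

(** The threshold [4 < #|T|] is where a second matching edge away from [c]
    becomes available; the path on four vertices only reaches 5. *)
Lemma pair_ecc_central : 4 <= #|T| -> exists c,
  5 <= pair_ecc c /\
  forall x, x != c -> x != p c -> 5 + (4 < #|T|).*2 <= pair_ecc x.
Proof.
move=> n4.
have [x0 _] : exists x : T, x \in T by apply/card_gt0P; exact: leq_trans n4.
have [c _ cmin] := arg_minnP (@ecc T) (isT : xpredT x0).
have {}cmin (y : T) : ecc c <= ecc y by exact: cmin.
(* avoiding c, p c and later x, p x produces further matching edges *)
have fresh (s : seq T) : size s < #|T| -> exists y, y \notin s.
  move=> ss; apply/existsP; apply: contraTT ss; rewrite negb_exists -leqNgt.
  move=> /forallP all_s; rewrite (leq_trans _ (card_size s)) //.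
  by apply/subset_leq_card/subsetP => y _; have := all_s y; rewrite negbK.
have swap x : x != p c -> p x != c by apply: contra_neq => <-; rewrite pK.
exists c; have [ec|ec] := leqP 3 (ecc c).
  split; first by have := cmin (p c); rewrite /pair_ecc; lia.
  move=> x xc /swap pxc.
  by have := pair_ecc_radius_ge3 cmin ec xc pxc; case: (4 < _); lia.
split.
  have [|x] := fresh [:: c; p c]; first exact: leq_trans n4.
  rewrite !inE negb_or => /andP[xc /swap pxc].
  by have [] := pair_ecc_radius2_centre ec xc pxc.
move=> x xc /swap pxc; case: ltnP => n5 /=; last first.
  by have [] := pair_ecc_radius2_centre ec xc pxc.
have [|y] := fresh [:: c; p c; x; p x]; first exact: leq_trans n5.
rewrite !inE !negb_or => /and4P[yc /swap pyc yx ypx].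
exact: (pair_ecc_radius2 ec xc pxc yc pyc yx ypx).
Qed.

Lemma tau_lower_bound : 4 <= #|T| ->
  10 + (#|T| - 2) * (5 + (4 < #|T|).*2) <= (tau T).*2.
Proof.
move=> n4; have [c [fc fx]] := pair_ecc_central n4.
rewrite double_tau (bigD1 c) //= (bigD1 (p c)) ?partner_neq //= pair_eccC addnA.
apply: leq_add; first by lia.
have -> : #|T| - 2 = #|[pred x | (x != c) && (x != p c)]|.
  have := cardC (pred2 c (p c)); rewrite card2 eq_sym partner_neq => <-.
  by rewrite addKn; apply: eq_card => x; rewrite !inE negb_or.
rewrite -sum_nat_const; apply: leq_sum => x; rewrite inE => /andP[xc xpc].
exact: fx.
Qed.

End LowerBound.

(** * The spider attains the bound *)

(** A highest vertex of a cycle has two distinct neighbours on the cycle, none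
    of them higher. *)
Lemma acyclic_of_height (G : sgraph) (h : G -> nat) :
  (forall x y z : G, adj x y -> adj x z -> h y <= h x -> h z <= h x -> y = z) ->
  acyclic G.
Proof.
move=> uniq_down c sc; apply/negP => cyc.
have [x0 x0c] : exists x, x \in c.
  by case: c sc {cyc} => // x; exists x; rewrite inE eqxx.
have [x xc xmax] := arg_maxnP h (x0c : mem c x0).
have [i q Eq] := rot_to xc.
have : ucycle (@adj G) (rot i c) by rewrite rot_ucycle.
have mq y : y \in x :: q -> h y <= h x by rewrite -Eq mem_rot; apply: xmax.
rewrite -(size_rot i) Eq in sc *.
(* y follows and z precedes x on the cycle *)
case/lastP: q sc mq {Eq} => [|[|y q] z] // _ mq.
rewrite /ucycle /= rcons_path last_rcons => /andP[/andP[axy /andP[_ azx]]].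
rewrite adj_sym in azx; rewrite mem_rcons.
have -> : y = z.
  by apply: (uniq_down x); rewrite ?mq // ?inE ?mem_rcons ?inE eqxx ?orbT.
by rewrite inE eqxx andbF.
Qed.

Section Spider.
Variable n : nat.
Local Notation m := (n./2).-1.
Local Notation S := (Sstar n).
Local Notation centre := (inl false : S).

Definition depth (x : S) : nat :=
  match x with inl b => b | inr (_, b) => b.+1 end.

Lemma depth_walk (x : S) : exists p, [/\ path (@adj S) x p, last x p = centre
  & size p = depth x].
Proof.
case: x => [[]|[i []]].
- by exists [:: centre].
- by exists [::].
- by exists [:: (inr (i, false) : S); centre]; rewrite /= /Sstar_adj /= eqxx.
- by exists [:: centre].
Qed.

Lemma Sstar_connected : connected S.
Proof.
have toc x : connect (@adj S) x centre.
  by have [p [pp lp _]] := depth_walk x; apply/connectP; exists p.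
move=> x y; apply: connect_trans (toc x) _.
by rewrite (sym_connect_sym (@adj_sym S)).
Qed.

Lemma Sstar_acyclic : acyclic S.
Proof.
apply: (@acyclic_of_height S depth).
move=> [[]|[i []]] [[]|[j []]] [[]|[k []]] //=; rewrite /Sstar_adj /= ?orbF //.
by move=> /eqP-> /eqP->.
Qed.

Lemma Sstar_conjugated : conjugated S.
Proof.
pose leg (x : S) := if x is inr (i, _) then Some i else None.
exists (preim_partition leg setT); apply/andP; split.
  2: exact: preim_partitionP.
apply/subsetP => B /imsetP[x _ ->]; apply/imsetP.
(* y false and y true are the two vertices of the block of x *)
pose y b : S := if x is inr (i, _) then inr (i, b) else inl b.
exists (y false, y true).
  by rewrite inE /y; case: x {y} => [b|[i b]]; rewrite /= /Sstar_adj /= ?eqxx.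
apply/setP=> z; rewrite !inE /y /=.
case: x {y} => [b|[i b]]; case: z => [[]|[j []]] //=;
  apply/eqP/orP => [[->]|[]/eqP[] // ->] //; rewrite eqxx; auto.
Qed.

Lemma card_Sstar : 4 <= n -> ~~ odd n -> #|S| = n.
Proof.
by rewrite card_sum card_prod card_bool card_ord; lia.
Qed.

Lemma Sstar_dist_le (x y : S) : dist x y <= depth x + depth y.
Proof.
have [p [pp lp sp]] := depth_walk x; have [q [pq lq sq]] := depth_walk y.
have dx := dist_le_size Sstar_connected pp.
have dy := dist_le_size Sstar_connected pq.
rewrite lp sp in dx; rewrite lq sq (dist_sym Sstar_connected) in dy.
have := dist_triangle Sstar_connected centre x y; lia.
Qed.

Lemma Sstar_ecc_inl b : ecc (inl b : S) <= b + 2.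
Proof.
apply/bigmax_leqP => y _; apply: leq_trans (Sstar_dist_le _ _) _.
by rewrite leq_add2l; case: y => [[]|[i []]].
Qed.

(** Another leg, and hence a vertex at distance [b.+1 + 2] from here, exists
    only when [1 < m]. *)
Lemma Sstar_ecc_inr i b : ecc (inr (i, b) : S) <= b.+2 + (1 < m).
Proof.
apply/bigmax_leqP => y _; have := Sstar_dist_le (inr (i, b)) y.
case: y => [b'|[j b']] /=; first by case: b'; lia.
have [<-|ij] := eqVneq i j; last first.
  have -> : 1 < m by move: ij (ltn_ord i) (ltn_ord j); rewrite -val_eqE /=; lia.
  by case: b'; lia.
have := @dist_le_size S Sstar_connected (inr (i, b)) [:: inr (i, b')].
have [<-|bb'] := eqVneq b b'.
  by rewrite distxx //; apply: Sstar_connected.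
have -> : path (@adj S) (inr (i, b)) [:: inr (i, b')].
  by rewrite /= /Sstar_adj; case: b b' bb' => [] [] //= _; rewrite eqxx.
by move=> /(_ isT) /=; lia.
Qed.

Lemma tau_Sstar_le : tau S <= 5 + m * (5 + (1 < m).*2).
Proof.
rewrite /tau big_sumType /= big_bool; apply: leq_add.
  exact: leq_add (Sstar_ecc_inl true) (Sstar_ecc_inl false).
rewrite -[X in X * _]card_ord -sum_nat_const.
rewrite (eq_bigr (fun u => ecc (inr (u.1, u.2) : S))); last by case.
rewrite -(pair_bigA _ (fun i b => ecc (inr (i, b) : S))) /=.
apply: leq_sum => i _; rewrite big_bool /=.
apply: leq_trans (leq_add (Sstar_ecc_inr i true) (Sstar_ecc_inr i false)) _; lia.
Qed.

End Spider.

Theorem theorem4p3 (n : nat) (hn : 4 <= n) (hev : ~~ odd n) :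
  [/\ #|Sstar n| = n, is_tree (Sstar n) & conjugated (Sstar n)] /\
  (forall T : sgraph, #|T| = n -> is_tree T -> conjugated T ->
     tau (Sstar n) <= tau T).
Proof.
split; first split.
- exact: card_Sstar.
- by split; [apply: Sstar_connected | apply: Sstar_acyclic].
- exact: Sstar_conjugated.
move=> T cardT treeT /conjugated_partner[p [pK adjp]].
have := tau_lower_bound treeT pK adjp; rewrite cardT => /(_ hn) lowT.
rewrite -leq_double; apply: leq_trans lowT.
have -> : (4 < n) = (1 < (n./2).-1) by lia.
have -> : n - 2 = (n./2).-1.*2 by lia.
by rewrite -doubleMl -[10]/(5.*2) -doubleD leq_double tau_Sstar_le.
Qed.
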